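(* Let $2\le k\le n$ and let $D$ be a strong digraph of order $n$. Then $1\le \lambda_k(D)\le n-1$. Moreover, both bounds are sharp, and $\lambda_k(D)=n-1$ holds if and only if $D\cong\overleftrightarrow{K}_n$ and either $k\notin\{4,6\}$, or $k\in\{4,6\}$ and $k<n$.
   Context: Digraphs are finite, without loops or parallel arcs; strong means strongly connected. $\overleftrightarrow{K}_n$ is the complete digraph on $n$ vertices. For $S\subseteq V(D)$, $\lambda_S(D)$ is the maximum number of pairwise arc-disjoint strong subgraphs of $D$ containing $S$, and $\lambda_k(D)=\min\{\lambda_S(D): S\subseteq V(D), |S|=k\}$. *)

(* Defs.v *)
From mathcomp Require Import all_boot.
Set Implicit Arguments. Unset Strict Implicit. Unset Printing Implicit Defensive.

(* A digraph on a finite vertex type T is given by its arc set A : {set T * T}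
   (so no parallel arcs); loops are excluded by [digraph]. *)
Section Digraphs.
Variable T : finType.

Definition digraph (A : {set T * T}) : bool := [forall x : T, (x, x) \notin A].

Definition reach (B : {set T * T}) : rel T := connect (fun u v => (u, v) \in B).

Definition strong (A : {set T * T}) : bool := [forall x, forall y, reach A x y].

Definition strong_sub (A : {set T * T}) (V : {set T}) (B : {set T * T}) : bool :=
  [&& B \subset A,
      [forall p in B, (p.1 \in V) && (p.2 \in V)] &
      [forall x in V, forall y in V, reach B x y]].

Definition packing (A : {set T * T}) (S : {set T}) (m : nat) : bool :=
  [exists F : {ffun 'I_m -> {set T} * {set T * T}},
     [forall i, strong_sub A (F i).1 (F i).2 && (S \subset (F i).1)] &&
     [forall i, forall j, (i != j) ==> [disjoint (F i).2 & (F j).2]]].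

(* lambda_S(D): the maximum size of such a packing.  For |S| >= 2 every
   member has at least one arc, so the maximum is at most #|A|. *)
Definition lambdaS (A : {set T * T}) (S : {set T}) : nat :=
  \max_(m < #|A|.+1 | packing A S m) m.

Definition lambdak (A : {set T * T}) (k : nat) : nat :=
  \big[minn/#|A|]_(S : {set T} | #|S| == k) lambdaS A S.
End Digraphs.

Definition Kn (n : nat) : {set 'I_n * 'I_n} := [set p | p.1 != p.2].

Definition diso (T T' : finType) (A : {set T * T}) (B : {set T' * T'}) : Prop :=
  exists f : T -> T', bijective f /\ forall x y, ((x, y) \in A) = ((f x, f y) \in B).

(* Main.v *)
Require Import Defs.
From mathcomp Require Import all_boot zify.
From Stdlib Require Import Relation_Operators.
Set Implicit Arguments. Unset Strict Implicit. Unset Printing Implicit Defensive.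

(* The upper bound holds because each member of a packing uses an arc leaving a
   fixed vertex of S, so lambda_k = n - 1 forces all arcs to be present.
   Conversely, in the complete digraph, a decomposition of the complete digraph
   on S into |S| - 1 strong spanning parts, together with one star v <-> S for
   each v outside S, is a packing of size n - 1.  Such a decomposition exists
   for |S| <> 4, 6 (Tillson), and for |S| = 4, 6 one enlarges S by one vertex.

   For odd order 2h+1 the decomposition consists of the translates of the
   Walecki zigzag oo, 0, 1, -1, 2, -2, ..., h over Z_2h with a point oo added.
   For even order 2h+2 with h >= 3, take a Hamiltonian path of the odd order
   digraph that uses exactly one arc of each zigzag, reroute each of its arcs
   through a new vertex w, and close the path itself up through w to obtain the
   additional part.  Such a path is, for h even,
     oo, 1, 3, ..., h-1, h, h+1, h+3, ..., 2h-1, 0, 2, ..., h-2, h+2, ..., 2h-2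
   and, for h odd,
     0, 1, 3, ..., 2h-1, oo, h+1, h+3, ..., 2h-2, 2, 4, ..., h-1.

   For k = n = 4, 6 counting arcs makes every part the graph of a function, and
   following the n - 1 functions from one vertex gives Hamiltonian paths with
   pairwise no common arc; labelling vertices along the first path, a search
   over the other n - 2 paths finds none. *)

(** * Arc colourings with strong classes, and walks in them *)

Definition class_arc n (col : nat -> nat -> nat) c x y : Prop :=
  [/\ x < n, y < n, x != y & col x y = c].

(** Disjointness of the classes is built in, since an arc has one colour. Vertices and colours are
    natural numbers so that the explicit formulas reduce to linear arithmetic. *)
Definition strong_coloring n (col : nat -> nat -> nat) : Prop :=
  forall c x y, c < n.-1 -> x < n -> y < n ->
    clos_refl_trans nat (class_arc n col c) x y.

Lemma rt_walk (E : nat -> nat -> Prop) (f : nat -> nat) i j :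
  i <= j -> (forall t, i <= t < j -> E (f t) (f t.+1)) ->
  clos_refl_trans nat E (f i) (f j).
Proof.
move=> le_ij; rewrite -(subnKC le_ij); elim: (j - i) => [|k IH] Ef.
  by rewrite addn0; apply: rt_refl.
apply: (rt_trans _ _ _ (f (i + k))); first by apply: IH => t t_lt; apply: Ef; lia.
by rewrite addnS; apply/rt_step/Ef; lia.
Qed.

(** Go on from position i to the end, which is also the start, and from there to j. *)
Lemma rt_closed_walk (E : nat -> nat -> Prop) (f : nat -> nat) m i j :
  f m = f 0 -> (forall t, t < m -> E (f t) (f t.+1)) ->
  i <= m -> j <= m -> clos_refl_trans nat E (f i) (f j).
Proof.
move=> f_closed Ef le_im le_jm; apply: (rt_trans _ _ _ (f m)).
  by apply: rt_walk => // t t_lt; apply: Ef; lia.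
by rewrite f_closed; apply: rt_walk => // t t_lt; apply: Ef; lia.
Qed.

(** * Odd orders: the zigzags *)

(** The residue modulo N of a number below 2N. *)
Definition reduce N x := if x < N then x else x - N.

(* Vertex 2h stands for oo.  The arcs of the zigzag i inside Z_2h are the
   i - j -> i + 1 + j and the i + j -> i - j, so the arc x -> x + d has colour
   x + (d - 1)/2 for odd d and x + d/2 + h for even d, with 0 < d < 2h. *)
Definition zigzag_color h x y :=
  let N := h.*2 in
  if y == N then reduce N (x + h)
  else if x == N then y
  else let d := if x <= y then y - x else y + N - x in
       reduce N (x + d./2 + if odd d then 0 else h).

(** The closed walk oo, i, i+1, i-1, ..., i+h, oo, with oo at both positions 0 and 2h+1. *)
Definition zigzag h i t :=
  let N := h.*2 in
  if (t == 0) || (t == N.+1) then N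
  else reduce N (if odd t then i + N - t./2 else i + t./2).

Lemma zigzag_color_walk h i t : i < h.*2 -> t < h.*2.+1 ->
  class_arc h.*2.+1 (zigzag_color h) i (zigzag h i t) (zigzag h i t.+1).
Proof.
move=> i_lt t_lt; rewrite /class_arc /zigzag /zigzag_color /reduce.
have [t0|t_gt0] := eqVneq t 0.
  by rewrite t0; split; repeat case: ifP => //=; lia.
have [tN|tN] := eqVneq t h.*2.
  by rewrite tN; split; repeat case: ifP => //=; lia.
have -> : (t == h.*2.+1) = false by lia.
have -> : (t.+1 == 0) || (t.+1 == h.*2.+1) = false by lia.
have [ot|et] := boolP (odd t).
- have -> : odd t.+1 = false by lia.
  by rewrite /=; split; repeat case: ifP => //=; lia.
- have -> : odd t.+1 by lia.
  by rewrite /=; split; repeat case: ifP => //=; lia.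
Qed.

Lemma zigzag_onto h i x : i < h.*2 -> x < h.*2.+1 ->
  exists2 t, t <= h.*2.+1 & zigzag h i t = x.
Proof.
move=> i_lt x_lt; case: (eqVneq x h.*2) => [->|xN]; first by exists 0.
(* The offset of x from i modulo 2h: an offset d with 0 < d <= h sits at position 2d, an offset -e
   with 0 <= e < h at position 2e+1. *)
pose d := if i <= x then x - i else x + h.*2 - i.
have d_lt : d < h.*2 by rewrite /d; case: ifP; lia.
case: (posnP d) => [d0|d_gt0]; last case: (leqP d h) => d_h.
- exists 1; rewrite /zigzag /reduce /=; first lia.
  by move: d0; rewrite /d; repeat case: ifP; lia.
- exists d.*2; rewrite /zigzag /reduce /=; first lia.
  by move: d_gt0 d_h d_lt; rewrite /d; repeat case: ifP; lia.
- exists (h.*2 - d).*2.+1; rewrite /zigzag /reduce /=; first lia.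
  by move: d_gt0 d_h d_lt; rewrite /d; repeat case: ifP; lia.
Qed.

Lemma zigzag_coloring h : strong_coloring h.*2.+1 (zigzag_color h).
Proof.
move=> c x y c_lt x_lt y_lt.
have [i i_le <-] := zigzag_onto c_lt x_lt; have [j j_le <-] := zigzag_onto c_lt y_lt.
apply: (@rt_closed_walk _ _ h.*2.+1) => //; first by rewrite /zigzag eqxx orbT.
by move=> t t_lt; apply: zigzag_color_walk.
Qed.

(** * Adding a vertex along a path that meets every colour *)

(* Vertex n is the new one and P, with inverse pos, the path to be rerouted. *)
Definition extend_color n col (P pos : nat -> nat) x y :=
  if x == n then (if pos y == 0 then n.-1 else col (P (pos y).-1) y)
  else if y == n then (if pos x == n.-1 then n.-1 else col x (P (pos x).+1))
  else if pos y == (pos x).+1 then n.-1 else col x y.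

Lemma rt_map (E E' : nat -> nat -> Prop) x y :
  (forall u v, E u v -> clos_refl_trans nat E' u v) ->
  clos_refl_trans nat E x y -> clos_refl_trans nat E' x y.
Proof.
move=> sub; elim=> [u v /sub //|u|u v w _ uv _ vw]; first exact: rt_refl.
exact: rt_trans uv vw.
Qed.

(** The new colour n-1 runs through n, P 0, ..., P (n-1), n. In an old class, each arc taken away by
    the path is replaced by a detour through n; as the path meets every colour, each old class has
    such a detour, which joins it to n. *)
Lemma extend_strong_coloring n col (P pos : nat -> nat) :
  1 < n -> strong_coloring n col ->
  (forall t, t < n -> P t < n /\ pos (P t) = t) ->
  (forall x, x < n -> pos x < n /\ P (pos x) = x) ->
  (forall c, c < n.-1 -> exists2 t, t < n.-1 & col (P t) (P t.+1) = c) ->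
  strong_coloring n.+1 (extend_color n col P pos).
Proof.
move=> n_gt1 col_strong posK PK rainbow c x y c_lt x_lt y_lt.
set E := class_arc _ _ _.
suff [to_n from_n] : (forall z, z < n.+1 -> clos_refl_trans nat E z n) /\
    (forall z, z < n.+1 -> clos_refl_trans nat E n z).
  by apply: (rt_trans _ _ _ n); [apply: to_n | apply: from_n].
have n_refl z : z < n.+1 -> z < n \/ z = n by lia.
have [cn|cn] := eqVneq c n.-1.
  pose w t := if t is t'.+1 then if t == n.+1 then n else P t' else n.
  have w_arc t : t < n.+1 -> E (w t) (w t.+1).
    rewrite /w /E /class_arc /extend_color cn; case: t => [|t] t_lt.
      have -> : (1 == n.+1) = false by lia.
      by have [? ->] := posK 0 ltac:(lia); rewrite eqxx /=; split=> //; lia.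
    have -> : (t.+1 == n.+1) = false by lia.
    have [? posP] := posK t ltac:(lia).
    have [tn|tn] := eqVneq t.+2 n.+1.
      rewrite posP !eqxx; have -> : t == n.-1 by lia.
      have -> : (P t == n) = false by lia.
      by split; lia.
    have [? posP'] := posK t.+1 ltac:(lia).
    have -> : (P t == n) = false by lia.
    have -> : (P t.+1 == n) = false by lia.
    rewrite posP posP' eqxx; split; try lia.
    by apply/eqP => eqP; move: posP'; rewrite -eqP posP; lia.
  have w_closed : w n.+1 = w 0 by rewrite /w eqxx.
  have w_onto z : z < n -> exists2 t, t <= n.+1 & w t = z.
    move=> z_lt; have [pz Pz] := PK z z_lt; exists (pos z).+1; first lia.
    by rewrite /w ifN //; lia.
  split=> z /n_refl[/w_onto[t t_le <-]|->]; try exact: rt_refl.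
    by apply: (@rt_closed_walk E w n.+1 t 0).
  by apply: (@rt_closed_walk E w n.+1 0 t).
have c_ltn : c < n.-1 by lia.
(* The path arc of colour c whose detour joins n to this class. *)
have [t t_lt colt] := rainbow c c_ltn.
have [Pt posPt] := posK t ltac:(lia).
have [Pt' posPt'] := posK t.+1 ltac:(lia).
have into : E (P t) n.
  rewrite /E /class_arc /extend_color eqxx posPt.
  have -> : (P t == n) = false by lia.
  have -> : (t == n.-1) = false by lia.
  by split; lia.
have out : E n (P t.+1).
  by rewrite /E /class_arc /extend_color eqxx posPt'; split => //; lia.
(* Old arcs of colour c survive, except those on the path, which become two arcs through n. *)
have lift u v : u < n -> v < n -> clos_refl_trans nat E u v.
  move=> u_lt v_lt; apply: rt_map (col_strong c u v c_ltn u_lt v_lt).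
  move=> a b [a_lt b_lt ab colab].
  have an : (a == n) = false by lia.
  have bn : (b == n) = false by lia.
  have [/eqP pab|pab] := boolP (pos b == (pos a).+1); last first.
    apply: rt_step; rewrite /E /class_arc /extend_color an bn (negbTE pab).
    by split=> //; lia.
  have [pa Pa] := PK a a_lt; have [pb Pb] := PK b b_lt.
  apply: (rt_trans _ _ _ n); apply: rt_step; rewrite /E /class_arc /extend_color.
    rewrite an eqxx; have -> : (pos a == n.-1) = false by lia.
    by rewrite -pab Pb; split=> //; lia.
  by rewrite eqxx pab /= Pa; split=> //; lia.
split=> z /n_refl[z_lt|->]; try exact: rt_refl.
  by apply: (rt_trans _ _ _ (P t)); [apply: lift | apply: rt_step].
by apply: (rt_trans _ _ _ (P t.+1)); [apply: rt_step | apply: lift].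
Qed.

(** * Hamiltonian paths meeting every colour, and the even orders *)

(** For even h: one branch per run of step 2, with oo and h standing alone. *)
Definition path_even h t :=
  if t == 0 then h.*2
  else if t <= h./2 then t.*2.-1
  else if t == h./2.+1 then h
  else if t <= h.+1 then t.*2 - 3
  else if t <= h.+1 + h./2 then t.*2 - h.*2 - 4
  else t.*2 - h.*2 - 2.

Definition pos_even h x :=
  if x == h.*2 then 0
  else if x == h then h./2.+1
  else if odd x then (if x < h then x./2.+1 else x./2.+2)
  else if x < h then x./2 + h.+2 else x./2 + h.+1.

(** For odd h, with 0 and oo standing alone. *)
Definition path_odd h t :=
  if t == 0 then 0
  else if t <= h then t.*2.-1
  else if t == h.+1 then h.*2
  else if t <= h.+1 + h./2 then t.*2 - h - 3
  else t.*2 - h.*2 - h - 1.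

Definition pos_odd h x :=
  if x == 0 then 0
  else if odd x then x./2.+1
  else if x == h.*2 then h.+1
  else if h < x then (x + h + 3)./2 else (x + h.*2 + h + 1)./2.

Lemma path_evenK h t : 3 < h -> ~~ odd h -> t < h.*2.+1 ->
  path_even h t < h.*2.+1 /\ pos_even h (path_even h t) = t.
Proof.
move=> h_gt h_even t_lt; rewrite /path_even.
case: ifP => [?|?]; first by rewrite /pos_even eqxx; lia.
by repeat (case: ifP => ?); rewrite /pos_even; (split; first lia);
  rewrite /=; repeat case: ifP; lia.
Qed.

Lemma pos_evenK h x : 3 < h -> ~~ odd h -> x < h.*2.+1 ->
  pos_even h x < h.*2.+1 /\ path_even h (pos_even h x) = x.
Proof.
move=> h_gt h_even x_lt; rewrite /pos_even.
by repeat (case: ifP => ?); rewrite /path_even; (split; first lia);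
  rewrite /=; repeat case: ifP; lia.
Qed.

Lemma path_oddK h t : 2 < h -> odd h -> t < h.*2.+1 ->
  path_odd h t < h.*2.+1 /\ pos_odd h (path_odd h t) = t.
Proof.
move=> h_gt h_odd t_lt; rewrite /path_odd.
by repeat (case: ifP => ?); rewrite /pos_odd; (split; first lia);
  rewrite /=; repeat case: ifP; lia.
Qed.

Lemma pos_oddK h x : 2 < h -> odd h -> x < h.*2.+1 ->
  pos_odd h x < h.*2.+1 /\ path_odd h (pos_odd h x) = x.
Proof.
move=> h_gt h_odd x_lt; rewrite /pos_odd.
by repeat (case: ifP => ?); rewrite /path_odd; (split; first lia);
  rewrite /=; repeat case: ifP; lia.
Qed.

(** An arc x -> x+2 has colour x+1+h modulo 2h, so the runs give all colours but 0, 1, h-1, h and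
    2h-1. These come from h-2 -> h+2, oo -> 1, h-1 -> h, h -> h+1 and 2h-1 -> 0. *)
Lemma path_even_rainbow h c : 3 < h -> ~~ odd h -> c < h.*2 ->
  exists2 t, t < h.*2 &
    zigzag_color h (path_even h t) (path_even h t.+1) = c.
Proof.
move=> h_gt h_even c_lt.
(* The position of the arc of colour c; its tail and head are computed next. *)
pose t := if odd c then
    (if c == 1 then 0 else if c == h.-1 then h./2 else if c == h.*2.-1 then h.+1
     else if c < h then c./2 + h.+1 + h./2 else c./2 - h./2 + h.+2)
  else if c == 0 then h.+1 + h./2 else if c == h then h./2.+1
  else if c < h then c./2 + h./2.+1 else c./2 - h./2.
exists t; first by rewrite /t; repeat case: ifP; lia.
have -> : path_even h t = if odd c then
    (if c == 1 then h.*2 else if c == h.-1 then h.-1 else if c == h.*2.-1 then h.*2.-1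
     else if c < h then c + h.-1 else c - h.+1)
  else if c == 0 then h - 2 else if c == h then h
  else if c < h then c + h.-1 else c - h.+1.
  by rewrite /path_even /t; repeat case: ifP; lia.
have -> : path_even h t.+1 = if odd c then
    (if c == 1 then 1 else if c == h.-1 then h else if c == h.*2.-1 then 0
     else if c < h then c + h.+1 else c - h.-1)
  else if c == 0 then h.+2 else if c == h then h.+1
  else if c < h then c + h.+1 else c - h.-1.
  by rewrite /path_even /t; repeat case: ifP; lia.
rewrite /zigzag_color /reduce.
by repeat case: ifP; lia.
Qed.

(** The runs give all colours but 0, h-1, h and h+1, which come from 0 -> 1, 2h-1 -> oo, 2h-2 -> 2
    and oo -> h+1. *)
Lemma path_odd_rainbow h c : 2 < h -> odd h -> c < h.*2 ->
  exists2 t, t < h.*2 &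
    zigzag_color h (path_odd h t) (path_odd h t.+1) = c.
Proof.
move=> h_gt h_odd c_lt.
pose t := if c == 0 then 0 else if c == h then h.+1 + h./2
  else if c == h.-1 then h else if c == h.+1 then h.+1
  else if odd c then (if c < h then (c + h)./2 else (c - h)./2)
  else if c < h then c./2 + h.+1 else c./2 + h.
exists t; first by rewrite /t; repeat case: ifP; lia.
have -> : path_odd h t = if c == 0 then 0 else if c == h then h.*2 - 2
  else if c == h.-1 then h.*2.-1 else if c == h.+1 then h.*2
  else if c < h then c + h.-1 else c - h.+1.
  by rewrite /path_odd /t; repeat case: ifP; lia.
have -> : path_odd h t.+1 = if c == 0 then 1 else if c == h then 2
  else if c == h.-1 then h.*2 else if c == h.+1 then h.+1
  else if c < h then c + h.+1 else c - h.-1.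
  by rewrite /path_odd /t; repeat case: ifP; lia.
rewrite /zigzag_color /reduce.
by repeat case: ifP => //=; lia.
Qed.

Lemma strong_coloring_exists n : 1 < n -> n != 4 -> n != 6 ->
  exists col, strong_coloring n col.
Proof.
move=> n_gt1 n4 n6; have [odd_n|even_n] := boolP (odd n).
  exists (zigzag_color n./2); have {1}-> : n = n./2.*2.+1 by lia.
  exact: zigzag_coloring.
have [->|n2] := eqVneq n 2.
  exists (fun _ _ => 0) => c x y c_lt x_lt y_lt.
  have [->|xy] := eqVneq x y; first exact: rt_refl.
  by apply: rt_step; split=> //; lia.
(* With 2, 4 and 6 excluded, the even n = 2h+2 has h >= 3. *)
pose h := n./2.-1; have h_gt : 2 < h by lia.
have -> : n = h.*2.+2 by lia.
have [odd_h|even_h] := boolP (odd h).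
  exists (extend_color h.*2.+1 (zigzag_color h) (path_odd h) (pos_odd h)).
  apply: extend_strong_coloring => [||t|x|c]; first lia.
  - exact: zigzag_coloring.
  - exact: path_oddK.
  - exact: pos_oddK.
  - exact: path_odd_rainbow.
exists (extend_color h.*2.+1 (zigzag_color h) (path_even h) (pos_even h)).
have h_gt3 : 3 < h by lia.
apply: extend_strong_coloring => [||t|x|c]; first lia.
- exact: zigzag_coloring.
- exact: path_evenK.
- exact: pos_evenK.
- exact: path_even_rainbow.
Qed.

(** * From colourings to packings of complete digraphs *)

Definition complete (T : finType) : {set T * T} := [set p | p.1 != p.2].

Lemma rt_connect (T : finType) (e : rel T) (E : nat -> nat -> Prop) (f : nat -> T) x y :
  (forall u v, E u v -> e (f u) (f v)) ->
  clos_refl_trans nat E x y -> connect e (f x) (f y).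
Proof.
move=> sub; elim=> [u v /sub /connect1 //|u|u v w _ uv _ vw].
  exact: connect0.
exact: connect_trans uv vw.
Qed.

Lemma packing_complete (T : finType) (S : {set T}) col :
  1 < #|S| -> strong_coloring #|S| col -> packing (complete T) S #|T|.-1.
Proof.
move=> S_gt1 col_strong; pose k := #|S|.
have k_le : k <= #|T| by apply: max_card.
(* Each vertex outside S receives its own colour from k-1 on, for its star with S; with the k-1
   colours on S this makes |T|-1. *)
pose inS x := index x (enum S); pose outS x := k.-1 + index x (enum (~: S)).
pose color x y := if x \in S then (if y \in S then col (inS x) (inS y) else outS y)
                  else outS x.
(* This is S for c < k-1, and S with one further vertex for the other colours, so no arc with both
   ends outside S enters a part. *)
pose V c := [set x | (x \in S) || (outS x == c)].
pose B c := [set p : T * T | [&& p.1 != p.2, p.1 \in V c, p.2 \in V c &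
                                 color p.1 p.2 == c]].
apply/existsP; exists [ffun c : 'I_ _ => (V c, B c)].
apply/andP; split; last first.
  apply/forallP => i; apply/forallP => j; apply/implyP => ij.
  rewrite !ffunE /= disjoint_subset; apply/subsetP => p; rewrite !inE => /and4P[_ _ _ /eqP->].
  by rewrite !negb_and -[i == j :> nat]/(i == j) ij !orbT.
apply/forallP => c; rewrite ffunE /= andbC; apply/andP; split.
  by apply/subsetP => x xS; rewrite inE xS.
apply/and3P; split.
- by apply/subsetP => p; rewrite !inE => /andP[].
- by apply/forallP => p; apply/implyP; rewrite inE => /and4P[_ -> ->].
have S_in x : x \in S -> inS x < k by move=> xS; rewrite /k cardE index_mem mem_enum.
have [x0 x0S] : exists x0, x0 \in S by apply/set0Pn; rewrite -card_gt0; lia.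
apply/forallP => x; apply/implyP => xV; apply/forallP => y; apply/implyP => yV.
have [c_lt|c_ge] := ltnP c k.-1.
  have VS z : z \in V c -> z \in S.
    by rewrite inE => /orP[//|/eqP cE]; move: c_lt; rewrite -cE /outS; lia.
  have /= := @rt_connect _ (fun u v => (u, v) \in B c) _ (nth x0 (enum S)) _ _ _
     (col_strong c _ _ c_lt (S_in x (VS x xV)) (S_in y (VS y yV))).
  rewrite !nth_index ?mem_enum ?VS //; apply=> u v [u_lt v_lt uv colc].
  have uS : nth x0 (enum S) u \in S by rewrite -mem_enum mem_nth // -cardE.
  have vS : nth x0 (enum S) v \in S by rewrite -mem_enum mem_nth // -cardE.
  rewrite !inE /= uS vS /color uS vS /inS !index_uniq ?enum_uniq -?cardE //.
  by rewrite nth_uniq ?enum_uniq -?cardE // uv colc eqxx.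
(* The centre of the star of colour c. *)
pose v := nth x0 (enum (~: S)) (c - k.-1).
have c_idx : c - k.-1 < size (enum (~: S)).
  by rewrite -cardE cardsCs setCK -/k; have := ltn_ord c; lia.
have vS : v \notin S by rewrite -in_setC -mem_enum mem_nth.
have outv : outS v = c by rewrite /outS index_uniq ?enum_uniq //; lia.
have Vv z : z \in V c -> z \in S \/ z = v.
  rewrite inE; have [zS _|zS /= /eqP outz] := boolP (z \in S); [by left|right].
  move: zS; rewrite -in_setC -mem_enum => zS.
  rewrite -(nth_index x0 zS) /v; congr nth.
  by rewrite -outz addKn.
have vz z : z \in V c -> reach (B c) v z.
  move=> zV; case: (Vv z zV) => [zS|->]; last exact: connect0.
  apply: connect1; rewrite !inE /= zS (negbTE vS) /color (negbTE vS) outv eqxx /= andbT.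
  by apply: contraNneq vS => ->.
have zv z : z \in V c -> reach (B c) z v.
  move=> zV; case: (Vv z zV) => [zS|->]; last exact: connect0.
  apply: connect1; rewrite !inE /= zS (negbTE vS) /color zS (negbTE vS) outv eqxx /= andbT.
  by apply: contraNneq vS => <-.
exact: connect_trans (zv x xV) (vz y yV).
Qed.

(** * The out-degree bound and the extremal definitions *)

(** On a path from x to y, skip initial loops at x; the next arc leaves x. *)
Lemma strong_sub_out (T : finType) (A B : {set T * T}) (V : {set T}) x y :
  strong_sub A V B -> x \in V -> y \in V -> x != y ->
  exists z, [/\ (x, z) \in B, (x, z) \in A & z != x].
Proof.
case/and3P=> /subsetP BA _ reachB xV yV xy.
have /connectP[p xp yE] : reach B x y.
  by move/forallP/(_ x)/implyP/(_ xV)/forallP/(_ y)/implyP/(_ yV): reachB.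
elim: p x xp yE xy {xV reachB} => [|z p IH] x /= => [_ -> /eqP//|/andP[xz zp] yE xy].
have [zx|zx] := eqVneq z x; last by exists z; rewrite BA.
by rewrite zx in zp yE; exact: IH zp yE xy.
Qed.

(** Every member has an arc leaving x, as S has another vertex; by disjointness the chosen heads are
    distinct. *)
Lemma packing_leq_outdegree (T : finType) (A : {set T * T}) (S : {set T}) m x :
  x \in S -> 1 < #|S| -> packing A S m ->
  m <= #|[set y | ((x, y) \in A) && (y != x)]|.
Proof.
move=> xS S_gt1 /existsP[F /andP[/forallP F_strong /forallP F_disj]].
have [y yS yx] : exists2 y, y \in S & x != y.
  have [y] : exists y, y \in S :\ x.
    by apply/set0Pn; rewrite -card_gt0; have := cardsD1 x S; rewrite xS; lia.
  by rewrite !inE => /andP[yx yS]; exists y; rewrite // eq_sym.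
have out i : exists z, [&& (x, z) \in (F i).2, (x, z) \in A & z != x].
  have /andP[Fi /subsetP SF] := F_strong i.
  by have [z /and3P ?] := strong_sub_out Fi (SF x xS) (SF y yS) yx; exists z.
pose g i := xchoose (out i).
have gP i : [&& (x, g i) \in (F i).2, (x, g i) \in A & g i != x] := xchooseP (out i).
have g_inj : injective g.
  move=> i j gij; apply/eqP/negPn/negP => ij.
  move/forallP/(_ j): (F_disj i); rewrite ij /= => dis_ij.
  have /and3P[gi _ _] := gP i; have /and3P[gj _ _] := gP j.
  by rewrite -gij (disjointFr dis_ij gi) in gj.
rewrite -[m in m <= _]card_ord -(card_codom g_inj); apply/subset_leq_card/subsetP => z.
by case/codomP => i ->; rewrite inE; case/and3P: (gP i) => _ -> ->.
Qed.

Lemma outdegree_leq (T : finType) (A : {set T * T}) x :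
  #|[set y | ((x, y) \in A) && (y != x)]| <= #|T|.-1.
Proof.
rewrite -(cardC1 x); apply/subset_leq_card/subsetP => y.
by rewrite !inE => /andP[].
Qed.

Lemma packing_lambdaS (T : finType) (A : {set T * T}) (S : {set T}) :
  packing A S (lambdaS A S).
Proof.
rewrite /lambdaS; elim/big_ind: _ => [|m p Am Ap|//].
  by apply/existsP; exists [ffun _ => (set0, set0)]; apply/andP; split; apply/forallP => -[].
by rewrite /maxn; case: ifP.
Qed.

Lemma lambdaS_geq (T : finType) (A : {set T * T}) (S : {set T}) m :
  m <= #|A| -> packing A S m -> m <= lambdaS A S.
Proof. by rewrite -ltnS => m_lt; exact: (leq_bigmax_cond (Ordinal m_lt)). Qed.

Lemma lambdak_leq (T : finType) (A : {set T * T}) (S : {set T}) :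
  lambdak A #|S| <= lambdaS A S.
Proof.
rewrite /lambdak; have := mem_index_enum S; elim: (index_enum _) => // R r IH.
rewrite inE big_cons => /predU1P[<-|/IH Sr]; first by rewrite eqxx geq_minl.
by case: ifP => _ //; rewrite geq_min Sr orbT.
Qed.

(** The bound by [#|A|] serves both the default value of the minimum and the range of the maximum in
    [lambdaS]. *)
Lemma lambdak_geq (T : finType) (A : {set T * T}) k m :
  m <= #|A| -> (forall S : {set T}, #|S| = k -> packing A S m) ->
  m <= lambdak A k.
Proof.
move=> mA packm; rewrite /lambdak; elim/big_ind: _ => // [p q|S /eqP Sk].
  by rewrite leq_min => -> ->.
by apply: lambdaS_geq => //; apply: packm.
Qed.

Lemma superset_of_card (T : finType) (S : {set T}) k :
  #|S| <= k <= #|T| -> exists2 S' : {set T}, S \subset S' & #|S'| = k.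
Proof.
elim: k => [|k IH] /andP[Sk kT].
  by exists S => //; apply/eqP; rewrite -leqn0.
have [Sk'|Sk'] := eqVneq #|S| k.+1; first by exists S.
have [S' SS' S'k] : exists2 S' : {set T}, S \subset S' & #|S'| = k.
  by apply: IH; rewrite (ltnW kT) andbT -ltnS ltn_neqAle Sk'.
have [x xS'] : exists x, x \in ~: S'.
  by apply/set0Pn; rewrite -card_gt0 cardsCs setCK S'k subn_gt0.
exists (x |: S'); first exact: subset_trans SS' (subsetUr _ _).
by rewrite cardsU1 -in_setC xS' S'k.
Qed.

Lemma packing_sub (T : finType) (A : {set T * T}) (S S' : {set T}) m :
  S \subset S' -> packing A S' m -> packing A S m.
Proof.
move=> SS' /existsP[F /andP[/forallP F_strong F_disj]]; apply/existsP; exists F.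
rewrite F_disj andbT; apply/forallP => i; have /andP[-> /=] := F_strong i.
exact: subset_trans.
Qed.

(** * Orders 4 and 6: no n-1 disjoint strong spanning parts *)

Definition steps (s : seq nat) := zip s (behead s).

Definition orthogonal (s t : seq nat) := ~~ has (mem (steps t)) (steps s).

(** A backtracking search for m pairwise orthogonal members, in which each choice filters the
    remaining candidates. *)
Fixpoint orthogonal_family m (cands : seq (seq nat)) : bool :=
  if m is m'.+1 then
    has (fun s => orthogonal_family m' (filter (orthogonal s) cands)) cands
  else true.

Lemma orthogonal_familyP (L cands : seq (seq nat)) :
  {subset L <= cands} -> pairwise orthogonal L -> orthogonal_family (size L) cands.
Proof.
elim: L cands => //= s L IH cands Lsub /andP[sL pL]; apply/hasP.
exists s; first by apply: Lsub; rewrite mem_head.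
apply: IH pL => t tL; rewrite mem_filter (allP sL t tL) Lsub //.
by rewrite inE tL orbT.
Qed.

(* The candidates are the Hamiltonian paths from 0 sharing no arc with
   0, 1, ..., n-1; the arcs closing them into cycles are ignored. *)
Definition candidates n :=
  [seq 0 :: s | s <- permutations (iota 1 n.-1) & orthogonal (iota 0 n) (0 :: s)].

(** Decided by evaluation, from at most 6 candidates for n = 4 and 120 for n = 6. *)
Lemma no_orthogonal_family n : n \in [:: 4; 6] ->
  orthogonal_family n.-2 (candidates n) = false.
Proof. by rewrite !inE => /orP[] /eqP->; vm_compute. Qed.

Lemma steps_map_traject (T : Type) (e : T -> nat) (f : T -> T) x n p :
  p \in steps (map e (traject f x n)) -> exists u, p = (e u, e (f u)).
Proof.
elim: n x => [|[|n] IH] x //=; rewrite inE => /predU1P[->|]; first by exists x.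
exact: IH (f x).
Qed.

Lemma map_index_uniq (T : eqType) (s : seq T) :
  uniq s -> map (index^~ s) s = iota 0 (size s).
Proof.
case: s => // x s s_uniq; apply: (@eq_from_nth _ 0); rewrite size_map ?size_iota //.
by move=> i i_lt; rewrite (nth_map x) // index_uniq // nth_iota.
Qed.

Lemma no_spanning_packing (T : finType) (A : {set T * T}) :
  #|T| \in [:: 4; 6] -> packing A setT #|T|.-1 -> False.
Proof.
move=> n46 /existsP[F /andP[/forallP F_strong /forallP F_disj]].
have n_gt1 : 1 < #|T| by move: n46; rewrite !inE => /orP[] /eqP->.
have m_gt0 : 0 < #|T|.-1 by lia.
have Fdis i j z : i != j -> z \in (F i).2 -> z \in (F j).2 -> False.
  move=> ij zi; move/forallP/(_ j): (F_disj i); rewrite ij /= => dis_ij.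
  by rewrite (disjointFr dis_ij zi).
have V_full i x : x \in (F i).1.
  by have /andP[_ /subsetP] := F_strong i; apply; rewrite inE.
have out i x : exists z, ((x, z) \in (F i).2) && (z != x).
  have [y yx] : exists y, y \in predC1 x by apply/card_gt0P; rewrite cardC1.
  have /andP[Fi _] := F_strong i; move: yx; rewrite inE eq_sym => xy.
  have [z [xz _ zx]] := strong_sub_out Fi (V_full i x) (V_full i y) xy.
  by exists z; rewrite xz.
pose g i x := xchoose (out i x).
have gP i x : ((x, g i x) \in (F i).2) && (g i x != x) := xchooseP (out i x).
have g_inj x : injective (g^~ x).
  move=> i j gij; apply/eqP/negPn/negP => /Fdis; apply.
    by case/andP: (gP i x) => + _; apply.
  by rewrite gij; case/andP: (gP j x).
(* The n-1 parts choose distinct heads at x among n-1 vertices, so every arc leaving x is chosen by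
   some part. *)
have g_onto x z : z != x -> exists i, z = g i x.
  move=> zx; apply/codomP.
  suff -> : codom (g^~ x) =i predC1 x by [].
  apply/subset_cardP; last by apply/subsetP => _ /codomP[i ->]; case/andP: (gP i x).
  by rewrite card_codom // card_ord cardC1.
have g_graph i x z : (x, z) \in (F i).2 -> z != x -> z = g i x.
  move=> xz /g_onto[j zE]; have [->//|ij] := eqVneq i j.
  by case: (Fdis _ _ _ ij xz); rewrite zE; case/andP: (gP j x).
(* Up to loops, part i consists of the arcs x -> [g i x]; being strong, it makes [g i] run through
   all vertices in a single orbit. *)
have g_conn i x y : fconnect (g i) x y.
  have /andP[/and3P[_ _ /forallP/(_ x)/implyP/(_ (V_full i x))/forallP Fi] _] := F_strong i.
  move/(_ y)/implyP/(_ (V_full i y)): Fi; apply: connect_sub => u v uv.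
  have [->|vu] := eqVneq v u; first exact: connect0.
  by rewrite (g_graph i u v) //; exact: fconnect1.
have orbit_full i x y : y \in orbit (g i) x by rewrite -fconnect_orbit.
have order_g i x : order (g i) x = #|T| by apply: eq_card => y; rewrite inE; apply: g_conn.
have [x0 _] : exists x0, x0 \in T by apply/card_gt0P; exact: ltnW.
(* Labelling along the orbit of [g i0] turns that path into 0, 1, ..., n-1; every orbit is started
   at [x0], which has label 0. *)
pose i0 := Ordinal m_gt0; pose e y := index y (orbit (g i0) x0).
have e_inj : injective e.
  by move=> y z eyz; rewrite -(nth_index x0 (orbit_full i0 x0 y)) [index _ _]eyz nth_index.
have e_lt y : e y < #|T| by rewrite -(order_g i0 x0) -size_orbit index_mem.
pose w i := map e (orbit (g i) x0).
have w0 : w i0 = iota 0 #|T|.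
  by rewrite /w map_index_uniq ?orbit_uniq // size_orbit order_g.
have w_step i p : p \in steps (w i) -> exists u, p = (e u, e (g i u)).
  exact: steps_map_traject.
have w_orth i j : i != j -> orthogonal (w i) (w j).
  move=> ij; apply/hasPn => p /w_step[u ->]; apply/negP.
  case/w_step=> v [/e_inj <- /e_inj gij].
  by move: ij; rewrite (g_inj _ _ _ gij) eqxx.
(* The other n-2 paths would be a family that the search must find. *)
pose L := map w (enum (predC1 i0)).
have size_L : size L = #|T|.-2.
  by rewrite size_map -cardE cardC1 card_ord.
have := no_orthogonal_family n46; rewrite -size_L orthogonal_familyP //.
  move=> _ /mapP[i + ->]; rewrite mem_enum /= => i_neq.
  have w_perm : perm_eq (w i) (iota 0 #|T|).
    have w_uniq : uniq (w i) by rewrite map_inj_uniq ?orbit_uniq.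
    apply: uniq_perm; rewrite ?iota_uniq //.
    have w_sub : {subset w i <= iota 0 #|T|}.
      by move=> k /mapP[y _ ->]; rewrite mem_iota /= add0n.
    by case: (uniq_min_size w_uniq w_sub); rewrite // size_iota size_map size_orbit order_g.
  have w_head : w i = 0 :: behead (w i).
    by rewrite /w /orbit -orderSpred /= /e /orbit -orderSpred /= eqxx.
  rewrite w_head; apply: map_f; rewrite mem_filter -w_head -w0 w_orth 1?eq_sym //=.
  move: w_perm; rewrite mem_permutations w_head -[X in iota 0 X]prednK; last lia.
  by rewrite /= perm_cons.
rewrite pairwise_map.
have := enum_uniq (predC1 i0); rewrite uniq_pairwise.
exact: sub_pairwise.
Qed.

(** * Bounds on lambda_k and the equality case *)

Lemma lambdak_leq_outdegree (T : finType) (A : {set T * T}) k x :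
  2 <= k <= #|T| ->
  lambdak A k <= #|[set y | ((x, y) \in A) && (y != x)]|.
Proof.
case/andP=> k_gt1 k_le.
have [S] : exists2 S : {set T}, [set x] \subset S & #|S| = k.
  by apply: superset_of_card; rewrite cards1 k_le ltnW.
rewrite sub1set => xS Sk; apply: leq_trans (packing_leq_outdegree xS _ (packing_lambdaS A S)).
  by rewrite -Sk lambdak_leq.
by rewrite Sk.
Qed.

Lemma strong_subT (T : finType) (A : {set T * T}) :
  strong A -> strong_sub A [set: T] A.
Proof.
move=> /forallP A_strong; apply/and3P; split=> //.
  by apply/forallP => p; rewrite !inE implybT.
apply/forallP => u; apply/implyP => _; apply/forallP => v.
by rewrite (forallP (A_strong u)) implybT.
Qed.

Lemma lambdak_gt0 (T : finType) (A : {set T * T}) k :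
  1 < #|T| -> strong A -> 0 < lambdak A k.
Proof.
move=> T_gt1 /strong_subT AT; apply: lambdak_geq => [|S _].
  (* Some arc exists, so the default value [#|A|] is positive. *)
  have [x _] : exists x, x \in T by apply/card_gt0P; exact: ltnW.
  have [y] : exists y, y \in predC1 x.
    by apply/card_gt0P; rewrite cardC1; case: #|T| T_gt1 => [|[]].
  rewrite inE eq_sym => xy.
  have [z [_ xz _]] := strong_sub_out AT (in_setT x) (in_setT y) xy.
  by apply/card_gt0P; exists (x, z).
apply/existsP; exists [ffun _ => (setT, A)]; apply/andP; split.
  by apply/forallP => i; rewrite ffunE /= subsetT AT.
by apply/forallP => i; apply/forallP => j; rewrite !ord1 eqxx.
Qed.

Lemma card_complete (T : finType) : #|complete T| = #|T| * #|T|.-1.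
Proof.
rewrite -sum1_card (eq_bigl (fun p => p.1 != p.2)); last by move=> p; rewrite inE.
rewrite -(pair_big_dep xpredT (fun x y => x != y) (fun _ _ => 1)) /=.
rewrite (eq_bigr (fun _ => #|T|.-1)) ?sum_nat_const // => x _.
by rewrite sum1_card -(cardC1 x); apply: eq_card => y; rewrite !inE eq_sym.
Qed.

Lemma packing_complete_cases (T : finType) (S : {set T}) :
  1 < #|S| -> (#|S| \notin [:: 4; 6]) \/ #|S| < #|T| ->
  packing (complete T) S #|T|.-1.
Proof.
move=> S_gt1 S_case; have [S46|Sn46] := boolP (#|S| \in [:: 4; 6]); last first.
  have [S4 S6] : #|S| != 4 /\ #|S| != 6 by move: Sn46; rewrite !inE; lia.
  by have [col] := strong_coloring_exists S_gt1 S4 S6; apply: packing_complete.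
have S_lt : #|S| < #|T| by case: S_case => //; rewrite S46.
(* Orders 5 and 7 have a decomposition, and a packing for the larger set also serves S. *)
have [S' SS' S'_card] : exists2 S' : {set T}, S \subset S' & #|S'| = #|S|.+1.
  by apply: superset_of_card; rewrite leqnSn S_lt.
apply: packing_sub SS' _.
have S'_gt1 : 1 < #|S'| by rewrite S'_card ltnW.
have [S4 S6] : #|S'| != 4 /\ #|S'| != 6.
  by rewrite S'_card; move: S46; rewrite !inE => /orP[] /eqP->.
by have [col] := strong_coloring_exists S'_gt1 S4 S6; apply: packing_complete.
Qed.

Lemma lambdak_complete (T : finType) k :
  2 <= k <= #|T| -> (k \notin [:: 4; 6]) \/ k < #|T| ->
  lambdak (complete T) k = #|T|.-1.
Proof.
move=> /[dup] k_bounds /andP[k_gt1 k_le] k_case.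
have [x _] : exists x, x \in T by apply/card_gt0P; apply: leq_trans k_le; exact: ltnW.
apply/eqP; rewrite eqn_leq (leq_trans (lambdak_leq_outdegree _ x k_bounds)) ?outdegree_leq //=.
apply: lambdak_geq => [|S Sk].
  by rewrite card_complete leq_pmull //; exact: leq_trans (ltnW k_gt1) k_le.
by apply: packing_complete_cases; rewrite Sk.
Qed.

(** Each out-degree is at least |T|-1, so all other vertices are out-neighbours. *)
Lemma lambdak_max_complete (T : finType) (A : {set T * T}) k :
  2 <= k <= #|T| -> digraph A -> lambdak A k = #|T|.-1 -> A = complete T.
Proof.
move=> k_bounds /forallP noloop lamA; apply/setP => -[x y]; rewrite inE /=.
have [<-|xy] := eqVneq x y; first exact: negbTE.
have := lambdak_leq_outdegree A x k_bounds; rewrite lamA -(cardC1 x) => out_ge.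
have sub : [set z | ((x, z) \in A) && (z != x)] \subset predC1 x.
  by apply/subsetP => z; rewrite !inE => /andP[].
have /subset_cardP/(_ sub)/(_ y) : #|[set z | ((x, z) \in A) && (z != x)]| = #|predC1 x|.
  by apply/eqP; rewrite eqn_leq out_ge subset_leq_card.
by rewrite !inE eq_sym xy andbT.
Qed.

Lemma diso_complete (T : finType) (A : {set T * T}) n :
  #|T| = n -> diso A (Kn n) <-> A = complete T.
Proof.
move=> cardT; split=> [[f [f_bij Af]]|->].
  by apply/setP => -[x y]; rewrite Af !inE /= (inj_eq (bij_inj f_bij)).
exists (cast_ord cardT \o enum_rank); split.
  apply: bij_comp; last exact: enum_rank_bij.
  by exists (cast_ord (esym cardT)); [apply: cast_ordK | apply: cast_ordKV].
by move=> x y; rewrite !inE /= (inj_eq (@cast_ord_inj _ _ _)) (inj_eq enum_rank_inj).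
Qed.

(** * Directed cycles, which attain the lower bound *)

Definition dicycle n : {set 'I_n * 'I_n} := [set p | p.2 == ordS p.1].

Lemma dicycle_strong n : strong (dicycle n).
Proof.
apply/forallP => x; apply/forallP => y.
have iterE k : iter k (@ordS n) x = (x + k) %% n :> nat.
  elim: k => [|k IH]; first by rewrite addn0 modn_small.
  by rewrite iterS /= IH -addn1 modnDml addn1 addnS.
(* One extra turn of n steps avoids truncated subtraction when y < x. *)
have -> : y = iter (n - x + y) (@ordS n) x.
  apply: val_inj; rewrite /= iterE addnA subnKC ?(ltnW (ltn_ord x)) //.
  by rewrite modnDl modn_small.
elim: (n - x + y) => [|k IH]; first exact: connect0.
by apply: connect_trans IH (connect1 _); rewrite inE /= eqxx.
Qed.

Lemma dicycle_digraph n : 1 < n -> digraph (dicycle n).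
Proof.
move=> n_gt1; apply/forallP => x; rewrite inE /=; apply/eqP => /(congr1 val) /= xE.
have [x_lt|x_ge] := ltnP x.+1 n; first by rewrite modn_small // in xE; lia.
have x_max : x.+1 = n by have := ltn_ord x; lia.
by move: xE; rewrite x_max modnn; lia.
Qed.

Lemma lambdak_dicycle n k : 2 <= k <= n -> lambdak (dicycle n) k = 1.
Proof.
move=> k_bounds; have n_gt1 : 1 < n by case/andP: k_bounds; apply: leq_trans.
apply/eqP; rewrite eqn_leq lambdak_gt0 ?card_ord ?dicycle_strong // andbT.
pose x := Ordinal (ltnW n_gt1); have k_bounds' : 2 <= k <= #|'I_n| by rewrite card_ord.
apply: leq_trans (lambdak_leq_outdegree _ x k_bounds') _.
rewrite -(cards1 (ordS x)); apply/subset_leq_card/subsetP => y.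
by rewrite !inE /= => /andP[].
Qed.

Theorem theorem3p6 :
  (forall (n k : nat) (T : finType) (A : {set T * T}),
      #|T| = n -> 2 <= k <= n -> digraph A -> strong A ->
      (1 <= lambdak A k <= n - 1) /\
      (lambdak A k = n - 1 <->
         diso A (Kn n) /\ ((k \notin [:: 4; 6]) \/ ((k \in [:: 4; 6]) /\ k < n))))
  /\
  (* sharpness of the lower bound *)
  (forall n k : nat, 2 <= k <= n ->
      exists A : {set 'I_n * 'I_n}, [/\ digraph A, strong A & lambdak A k = 1])
  /\
  (* sharpness of the upper bound *)
  (forall n k : nat, 2 <= k <= n -> ((k \notin [:: 4; 6]) \/ k < n) ->
      exists A : {set 'I_n * 'I_n}, [/\ digraph A, strong A & lambdak A k = n - 1]).
Proof.
split; last split.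
- move=> n k T A cardT k_bounds A_digraph A_strong.
  have k_boundsT : 2 <= k <= #|T| by rewrite cardT.
  have T_gt1 : 1 < #|T| by case/andP: k_boundsT; apply: leq_trans.
  have [x _] : exists x, x \in T by apply/card_gt0P; exact: ltnW.
  rewrite subn1 -{1 2}cardT lambdak_gt0 //=.
  rewrite (leq_trans (lambdak_leq_outdegree A x k_boundsT)) ?outdegree_leq //; split=> //.
  rewrite (diso_complete A cardT); split=> [lamA|[-> k_case]].
    have A_complete := lambdak_max_complete k_boundsT A_digraph lamA; split=> //.
    have [k46|] := boolP (k \in [:: 4; 6]); [right; split=> // | by left].
    (* If k = n, then S is the whole vertex set and a maximum packing would have n-1 spanning
       parts. *)
    case/andP: k_bounds => _; rewrite leq_eqVlt => /predU1P[kn|//]; exfalso.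
    apply: (@no_spanning_packing T A); first by rewrite cardT -kn.
    have lamS := lambdak_leq A [set: T]; rewrite cardsT cardT -kn lamA in lamS.
    suff <- : lambdaS A [set: T] = #|T|.-1 by apply: packing_lambdaS.
    apply/eqP; rewrite eqn_leq lamS andbT.
    apply: leq_trans (outdegree_leq A x).
    apply: packing_leq_outdegree (packing_lambdaS _ _) => //.
    by rewrite cardsT.
  by apply: lambdak_complete => //; rewrite cardT; case: k_case => [|[_]]; [left | right].
- move=> n k k_bounds; exists (dicycle n); split; last exact: lambdak_dicycle.
    by apply: dicycle_digraph; case/andP: k_bounds; apply: leq_trans.
  exact: dicycle_strong.
- move=> n k k_bounds k_case; exists (complete 'I_n); split.
  + by apply/forallP => x; rewrite inE eqxx.
  + apply/forallP => x; apply/forallP => y.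
    have [->|xy] := eqVneq x y; first exact: connect0.
    by apply: connect1; rewrite inE.
  + by rewrite lambdak_complete ?card_ord ?subn1.
Qed.
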